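(* Let $n\ge2$, let $K\subset\mathbb{R}^n$ be a convex body, let $C\subset\mathbb{R}^n$ be a Minkowski-centered convex body with $0$ in its interior, and let $s\in\mathbb{R}^n\setminus\{0\}$. Write $C_{\mathrm{MAX}}=\mathrm{conv}(C\cup(-C))$. Then: (i) $$b_{s,\mathrm{MAX}}(K,C)=\frac{h_K(s)+h_K(-s)}{h_{C_{\mathrm{MAX}}}(s)}=b_{s,\mathrm{MAX}}(K,C_{\mathrm{MAX}})=b_{s,\mathrm{AM}}(K,C_{\mathrm{MAX}})=b_{s,\mathrm{MAX}}\left(\tfrac{K-K}{2},C_{\mathrm{MAX}}\right)=b_{s,\mathrm{MAX}}\left(\tfrac{K-K}{2},C\right);$$ (ii) $$D_{\mathrm{MAX}}(K,C)=D_{\mathrm{MAX}}(K,C_{\mathrm{MAX}})=D_{\mathrm{MAX}}\left(\tfrac{K-K}{2},C_{\mathrm{MAX}}\right)=D_{\mathrm{MAX}}\left(\tfrac{K-K}{2},C\right)=D_{\mathrm{AM}}(K,C_{\mathrm{MAX}}).$$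
   Context: A convex body is a nonempty compact convex set. $h_C(a)=\max_{x\in C}a^Tx$ is the support function; $[x,y]$ is the segment with endpoints $x,y$. The circumradius is $R(K,C)=\inf\{\rho\ge0:\exists t,\ K\subset t+\rho C\}$. $C$ is Minkowski-centered if $C\subset -R(C,-C)\,C$. For a convex body $K$, a gauge $C$ (convex body with $0$ in its interior) and $s\ne0$: $$b_{s,\mathrm{MAX}}(K,C)=\frac{h_K(s)+h_K(-s)}{\max(h_C(s),h_C(-s))},\qquad b_{s,\mathrm{AM}}(K,C)=2\cdot\frac{h_K(s)+h_K(-s)}{h_C(s)+h_C(-s)},$$ $$D_{\mathrm{MAX}}(K,C)=\max_{s\ne0}b_{s,\mathrm{MAX}}(K,C),\qquad D_{\mathrm{AM}}(K,C)=\max_{x,y\in K}2R([x,y],C).$$ *)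

(* Defs.v *)
From mathcomp Require Export all_boot all_order all_algebra.
From mathcomp Require Export all_classical all_reals all_analysis.

Set Implicit Arguments.
Unset Strict Implicit.
Unset Printing Implicit Defensive.

Import Order.TTheory GRing.Theory Num.Theory.
Import numFieldNormedType.Exports.

Local Open Scope classical_set_scope.
Local Open Scope ring_scope.

Section defs.
Context {R : realType} {n : nat}.
Implicit Types (K C : set 'rV[R]_n) (a s x y : 'rV[R]_n).

Definition dot a x : R := (a *m x^T) 0 0.

Definition convex_body K := [/\ K !=set0, compact K & convex_set K].

(* Maxima are written with [sup]. That they are attained is proved below:
   [support_is_max], [support_C_MAX_is_max], [D_MAX_is_max], [D_AM_is_max];
   [half_diff_compact], [C_MAX_bounded], [C_MAX_convex] and [C_MAX_interior]
   make them applicable to (K - K) / 2 and to conv (C U -C). *)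
Definition support K a : R := sup [set dot a x | x in K].

Definition opp_set K : set 'rV[R]_n := [set - x | x in K].

Definition conv_hull K : set 'rV[R]_n := smallest (@convex_set R 'rV[R]_n) K.

Definition segment x y : set 'rV[R]_n :=
  [set (1 - l) *: x + l *: y | l in `[0, 1]%classic].

Definition homothet (t : 'rV[R]_n) (rho : R) C : set 'rV[R]_n :=
  [set t + rho *: x | x in C].

Definition circumradius K C : R :=
  inf [set rho : R | 0 <= rho /\ exists t, K `<=` homothet t rho C].

Definition Minkowski_centered C :=
  C `<=` [set - circumradius C (opp_set C) *: x | x in C].

(* (K - K) / 2 *)
Definition half_diff K : set 'rV[R]_n :=
  [set 2^-1 *: z | z in [set x - y | x in K & y in K]].

Definition C_MAX C : set 'rV[R]_n := conv_hull (C `|` opp_set C).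

Definition b_MAX s K C : R :=
  (support K s + support K (- s)) / Num.max (support C s) (support C (- s)).

Definition b_AM s K C : R :=
  2 * ((support K s + support K (- s)) / (support C s + support C (- s))).

Definition D_MAX K C : R := sup [set b_MAX s K C | s in [set s | s != 0]].

Definition D_AM K C : R :=
  sup [set 2 * circumradius (segment x y) C | x in K & y in K].

End defs.

Section attained.
Context {R : realType} {n : nat}.
Implicit Types (K C : set 'rV[R]_n) (a s x y : 'rV[R]_n).

Definition is_max (A : set R) (m : R) := A m /\ ubound A m.

Lemma sup_is_max (A : set R) (m : R) : is_max A m -> is_max A (sup A).
Proof.
move=> [Am Aub]; suff -> : sup A = m by [].
apply/le_anti/andP; split; first by apply: ge_sup => //; exists m.
by apply: ub_le_sup => //; exists m.
Qed.

Lemma lipschitz_cts (V : normedModType R) (f : V -> R) (M : R) :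
  (forall u v : V, f u <= f v + M * `|u - v|) -> continuous f.
Proof.
move=> fM x; apply/cvgrPdist_le => e e0.
have M1 : 0 < `|M| + 1 by rewrite ltr_wpDl.
apply/nbhs_ballP; exists (e / (`|M| + 1)) => /=; first exact: divr_gt0.
move=> y; rewrite -ball_normE /= ltr_pdivlMr// => xye.
have Me (z w : V) : M * `|z - w| <= `|z - w| * (`|M| + 1).
  by rewrite mulrC ler_wpM2l// (le_trans (ler_norm _))// lerDl.
rewrite ler_distl; apply/andP; split.
  rewrite lerBlDr; apply: le_trans (fM y x) _.
  by rewrite lerD2l; apply: le_trans (Me _ _) _; rewrite distrC ltW.
apply: le_trans (fM x y) _.
by rewrite lerD2l; apply: le_trans (Me _ _) _; rewrite ltW.
Qed.

Lemma dotE a x : dot a x = \sum_j a 0 j * x 0 j.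
Proof. by rewrite /dot mxE; apply: eq_bigr => j _; rewrite mxE. Qed.

Lemma dotBl a b x : dot (a - b) x = dot a x - dot b x.
Proof. by rewrite /dot mulmxBl !mxE. Qed.

Lemma dotZl c a x : dot (c *: a) x = c * dot a x.
Proof. by rewrite /dot -scalemxAl mxE. Qed.

Lemma coord_norm x j : `|x 0 j| <= `|x|.
Proof.
rewrite -[leRHS]/(mx_norm x) mx_normrE.
by apply/bigmax_geP; right; exists (0, j).
Qed.

Lemma dot_le a x : dot a x <= n%:R * `|x| * `|a|.
Proof.
have -> : n%:R * `|x| * `|a| = \sum_(j < n) `|x| * `|a|.
  by rewrite sumr_const card_ord -mulrA mulr_natl.
rewrite dotE ler_sum// => j _.
rewrite mulrC (le_trans (ler_norm _))// normrM.
by rewrite ler_pM//; exact: coord_norm.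
Qed.

Lemma bounded_setP K : bounded_set K ->
  exists2 M : R, 0 <= M & forall x, K x -> `|x| <= M.
Proof.
by move=> /pinfty_ex_gt0[M /ltW M0 KM]; exists M => // x /KM.
Qed.

Lemma support_has_ubound K a : bounded_set K ->
  has_ubound [set dot a x | x in K].
Proof.
move=> /bounded_setP[M M0 KM]; exists (n%:R * M * `|a|) => _ [x Kx <-].
by rewrite (le_trans (dot_le _ _))// ler_wpM2r// ler_wpM2l// KM.
Qed.

Lemma support_ub K a x : bounded_set K -> K x -> dot a x <= support K a.
Proof.
by move=> bK Kx; apply: ub_le_sup; [exact: support_has_ubound|exists x].
Qed.

Lemma support_le K a c : K !=set0 -> (forall x, K x -> dot a x <= c) ->
  support K a <= c.
Proof.
move=> [x Kx] Kc; apply: ge_sup; first by exists (dot a x), x.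
by move=> _ [y Ky <-]; exact: Kc.
Qed.

Lemma support_lipschitz K : K !=set0 -> bounded_set K ->
  exists M : R, forall a b, support K a <= support K b + M * `|a - b|.
Proof.
move=> K0 bK; have [M M0 KM] := bounded_setP bK.
exists (n%:R * M) => a b; apply: support_le => // x Kx.
have -> : dot a x = dot b x + dot (a - b) x by rewrite dotBl addrC subrK.
apply: lerD; first exact: support_ub.
by rewrite (le_trans (dot_le _ _))// ler_wpM2r// ler_wpM2l// KM.
Qed.

Lemma support_cts K : K !=set0 -> bounded_set K -> continuous (support K).
Proof.
by move=> K0 bK; have [M] := support_lipschitz K0 bK; exact: lipschitz_cts.
Qed.

Lemma supportN_cts K : K !=set0 -> bounded_set K ->
  continuous (fun a => support K (- a)).
Proof.
move=> K0 bK; have [M KM] := support_lipschitz K0 bK.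
apply: (@lipschitz_cts _ _ M) => a b.
by have := KM (- a) (- b); rewrite opprK [- a + b]addrC distrC.
Qed.

Lemma supportZ K c a : K !=set0 -> bounded_set K -> 0 < c ->
  support K (c *: a) = c * support K a.
Proof.
move=> K0 bK c0; apply/le_anti/andP; split.
  apply: support_le => // x Kx; rewrite dotZl ler_pM2l//.
  exact: support_ub.
rewrite -ler_pdivlMl//; apply: support_le => // x Kx.
by rewrite ler_pdivlMl// -dotZl; exact: support_ub.
Qed.

Lemma support_gt0 C a : bounded_set C -> C° 0 -> a != 0 -> 0 < support C a.
Proof.
move=> bC /nbhs_closedballP[e eC] a0.
have na : 0 < `|a| by rewrite normr_gt0.
have Cx : C ((e%:num / `|a|) *: a).
  apply: eC; rewrite closed_ballE//= /closed_ball_ /= sub0r normrN normrZ.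
  by rewrite ger0_norm ?divr_ge0// divfK ?gt_eqF.
apply: lt_le_trans (support_ub _ bC Cx).
suff : 0 < dot a a.
  move=> aa; rewrite /dot linearZ /= -scalemxAr mxE mulr_gt0//.
  exact: divr_gt0.
rewrite dotE; have [j aj] : exists j, a 0 j != 0.
  apply/existsP; apply: contraNT a0 => /existsPn a0.
  by apply/eqP/rowP => j; have /negPn/eqP -> := a0 j; rewrite mxE.
rewrite (bigD1 j)//= ltr_wpDr ?sumr_ge0// => [i _|]; first exact: sqr_ge0.
by rewrite -expr2 exprn_even_gt0.
Qed.

Lemma support_is_max K a : K !=set0 -> compact K ->
  is_max [set dot a x | x in K] (support K a).
Proof.
move=> K0 cK.
have ca : continuous (dot a).
  apply: (@lipschitz_cts _ _ (n%:R * `|a|)) => x y.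
  rewrite addrC -lerBlDr mulrAC (le_trans _ (dot_le _ _))//.
  by rewrite /dot linearB /= mulmxBr !mxE.
have [x /set_mem Kx xmax] := compact_EVT_max K0 cK (continuous_subspaceT ca).
apply: (@sup_is_max _ (dot a x)); split; first by exists x.
by move=> _ [y Ky <-]; apply: xmax; rewrite inE.
Qed.

Lemma b_MAXZ K C c s : K !=set0 -> bounded_set K -> C !=set0 ->
  bounded_set C -> 0 < c -> b_MAX (c *: s) K C = b_MAX s K C.
Proof.
move=> K0 bK C0 bC c0; rewrite /b_MAX -scalerN !supportZ//.
rewrite -maxr_pMr ?ltW// -mulrDr invfM mulrACA divff ?mul1r//.
by rewrite gt_eqF.
Qed.

Lemma D_MAX_is_max K C : (0 < n)%N -> K !=set0 -> bounded_set K ->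
  bounded_set C -> C° 0 ->
  is_max [set b_MAX s K C | s in [set s | s != 0]] (D_MAX K C).
Proof.
move=> n0 K0 bK bC iC.
have C0 : C !=set0 by exists 0; exact: interior_subset iC.
pose S : set 'rV[R]_n := [set s | `|s| = 1].
have norm1 s : s != 0 -> S (`|s|^-1 *: s).
  move=> s0; rewrite /S /= normrZ normfV normr_id mulVf//.
  by rewrite normr_eq0.
have S0 : S !=set0.
  exists (`|const_mx 1 : 'rV[R]_n|^-1 *: const_mx 1); apply: norm1.
  by apply/eqP => /rowP/(_ (Ordinal n0)); rewrite !mxE => /eqP; rewrite oner_eq0.
have cS : compact S.
  apply: bounded_closed_compact.
    by exists 1; split => // M M1 s /= ->; exact: ltW.
  have -> : S = Num.norm @^-1` [set 1] by [].
  by apply: preimage_closed => [s _|]; [exact: norm_continuous|exact: closed_eq].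
have cb : {within S, continuous (fun s => b_MAX s K C)}.
  apply: continuous_in_subspaceT => s /set_mem Ss.
  have s0 : s != 0 by rewrite -normr_eq0 Ss oner_eq0.
  have cK : support K t + support K (- t) @[t --> s] -->
      support K s + support K (- s).
    exact: cvgD (@support_cts K K0 bK s) (@supportN_cts K K0 bK s).
  have cC : Num.max (support C t) (support C (- t)) @[t --> s] -->
      Num.max (support C s) (support C (- s)).
    exact: (@continuous_max _ _ _ _ s) (@support_cts C C0 bC s) (@supportN_cts C C0 bC s).
  have h0 : Num.max (support C s) (support C (- s)) != 0.
    by rewrite gt_eqF// lt_max support_gt0.
  have cV : (Num.max (support C t) (support C (- t)))^-1 @[t --> s] -->
      (Num.max (support C s) (support C (- s)))^-1.
    exact: cvgV h0 cC.
  exact: cvgM cK cV.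
have [s /set_mem Ss smax] := compact_EVT_max S0 cS cb.
apply: (@sup_is_max _ (b_MAX s K C)); split.
  by exists s => //=; rewrite -normr_eq0 Ss oner_eq0.
move=> _ [t /= t0 <-]; rewrite -(@b_MAXZ _ _ `|t|^-1)//; last first.
  by rewrite invr_gt0 normr_gt0.
by apply: smax; rewrite inE; exact: norm1.
Qed.

Let radii K C := [set rho : R | 0 <= rho /\ exists t, K `<=` homothet t rho C].

Lemma radii_segment C x y x' y' (e rho : R) : convex_set C -> 0 < e ->
  (forall u, `|u| <= e -> C u) -> radii (segment x' y') C rho ->
  radii (segment x y) C (rho + e^-1 * `|(x, y) - (x', y')|).
Proof.
move=> cC e0 eC [rho0 [t xyt]].
set d := `|(x, y) - (x', y')|; set mu := e^-1 * d.
have d0 : 0 <= d by exact: normr_ge0.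
have mu0 : 0 <= mu by rewrite mulr_ge0// invr_ge0 ltW.
split; first exact: addr_ge0.
exists t => _ [l l01 <-].
have [l0 l1] : 0 <= l /\ l <= 1 by move: l01; rewrite /= in_itv /= => /andP.
have [c Cc ceq] := xyt _ (ex_intro2 _ _ l l01 erefl).
pose w := (1 - l) *: (x - x') + l *: (y - y').
have wd : `|w| <= d.
  have xd : `|x - x'| <= d by rewrite /d prod_normE le_max lexx.
  have yd : `|y - y'| <= d by rewrite /d prod_normE le_max lexx orbT.
  rewrite (le_trans (ler_normD _ _))// !normrZ !ger0_norm ?subr_ge0//.
  rewrite [leRHS](_ : d = (1 - l) * d + l * d); last first.
    by rewrite -mulrDl subrK mul1r.
  by rewrite lerD// ler_wpM2l// subr_ge0.
have -> : (1 - l) *: x + l *: y = t + (rho *: c + w).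
  rewrite addrA ceq /w addrACA -!scalerDr (addrCA x') (addrCA y').
  by rewrite !subrr !addr0.
have [m0|m0] := eqVneq mu 0.
  exists c => //; rewrite m0 addr0.
  have : d = 0.
    by apply/eqP; move/eqP: m0; rewrite mulf_eq0 invr_eq0 gt_eqF.
  by move=> d00; move: wd; rewrite d00 normr_le0 => /eqP ->; rewrite addr0.
have mp : 0 < mu by rewrite lt_def m0.
have rmp : 0 < rho + mu by rewrite ltr_wpDl.
exists ((rho + mu)^-1 *: (rho *: c + w)); last first.
  by rewrite scalerA divff ?scale1r// gt_eqF.
have k0 : 0 <= rho / (rho + mu) by rewrite divr_ge0// ltW.
have k1 : rho / (rho + mu) <= 1 by rewrite ler_pdivrMr// mul1r lerDl.
have Cu : C (mu^-1 *: w).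
  apply: eC; rewrite normrZ ger0_norm ?invr_ge0// ler_pdivrMl//.
  by rewrite /mu mulrAC mulVf ?mul1r// gt_eqF.
have := cC c (mu^-1 *: w) (@Itv01 R _ k0 k1).
rewrite !inE => /(_ Cc Cu); set k := rho / (rho + mu).
suff -> : (rho + mu)^-1 *: (rho *: c + w) = k *: c + (1 - k) *: (mu^-1 *: w).
  by [].
rewrite scalerDr !scalerA [_^-1 * rho]mulrC; congr (_ + _ *: _).
rewrite /k -[X in X - _](@divff _ (rho + mu)) ?gt_eqF// -mulrBl.
by rewrite [rho + mu]addrC addrK mulrAC divff ?mul1r.
Qed.

Lemma D_AM_is_max K C : K !=set0 -> compact K -> convex_set C -> C° 0 ->
  is_max
    [set 2 * circumradius (segment x y) C | x in K & y in K]
    (D_AM K C).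
Proof.
move=> [x0 Kx0] cK cC /nbhs_closedballP[e' eC0].
have e0 : 0 < e'%:num by [].
set e := e'%:num in e0 eC0.
have eC u : `|u| <= e -> C u.
  move=> ue; apply: eC0; rewrite closed_ballE//.
  by rewrite /closed_ball_ /= sub0r normrN.
pose f (z : 'rV[R]_n * 'rV[R]_n) := circumradius (segment z.1 z.2) C.
have lbr x y : has_lbound (radii (segment x y) C) by exists 0 => r [].
have r0 x y : radii (segment x y) C !=set0.
  have /(radii_segment x y cC e0 eC) : radii (segment 0 0) C 0.
    split=> //; exists 0 => _ [l _ <-]; exists 0; first by apply: eC; rewrite normr0 ltW.
    by rewrite !scaler0.
  by move=> h; eexists; exact: h.
have cf : continuous f.
  apply: (@lipschitz_cts _ _ e^-1) => -[x y] [x' y'].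
  rewrite -lerBlDr; apply: lb_le_inf; first exact: r0.
  move=> rho /(radii_segment x y cC e0 eC) h; rewrite lerBlDr.
  by apply: ge_inf h; exact: lbr.
have K20 : K `*` K !=set0 by exists (x0, x0).
have [[x y] /set_mem[/= Kx Ky] fmax] :=
  compact_EVT_max K20 (compact_setX cK cK) (continuous_subspaceT cf).
apply: (@sup_is_max _ (2 * f (x, y))); split.
  by exists x => //; exists y.
move=> _ [x' Kx' [y' Ky' <-]]; rewrite ler_pM2l//.
by apply: (fmax (x', y')); rewrite inE.
Qed.

Lemma compact_opp_set C : compact C -> compact (opp_set C).
Proof.
move=> cC; apply: (@continuous_compact _ _ (@GRing.opp 'rV[R]_n)) => //.
by apply: continuous_subspaceT => x; exact: opp_continuous.
Qed.

Lemma C_MAX_convex C : convex_set (C_MAX C).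
Proof.
move=> x y l; rewrite !inE => Hx Hy A HA; have [Aconv _] := HA.
by apply: set_mem; apply: Aconv; apply: mem_set; [exact: Hx|exact: Hy].
Qed.

Lemma sub_C_MAX C : C `<=` C_MAX C.
Proof. by move=> x Cx A [_ CA]; apply: CA; left. Qed.

Lemma C_MAX_interior C : C° 0 -> (C_MAX C)° 0.
Proof. exact: interiorS (@sub_C_MAX C) 0. Qed.

Lemma C_MAX_bounded C : bounded_set C -> bounded_set (C_MAX C).
Proof.
move=> /bounded_setP[M M0 CM].
suff H x : C_MAX C x -> `|x| <= M.
  exists M; split; first exact: num_real.
  by move=> N MN x /H /le_trans; apply; exact: ltW.
move=> /(_ [set y | `|y| <= M]); apply; split.
  move=> y z l; rewrite !inE /= => yM zM; rewrite /conv /=.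
  rewrite (le_trans (ler_normD _ _))// !normrZ !ger0_norm ?subr_ge0//.
  rewrite [leRHS](_ : M = l%:num * M + (1 - l%:num) * M); last first.
    by rewrite -mulrDl addrC subrK mul1r.
  by rewrite lerD// ler_wpM2l// subr_ge0.
by move=> y [/CM//|[z /CM zM <-]]; rewrite /= normrN.
Qed.

Lemma support_C_MAX_is_max C a : C !=set0 -> compact C ->
  is_max [set dot a x | x in C_MAX C] (support (C_MAX C) a).
Proof.
move=> [c Cc] cC.
have [[x CNx xE] xmax] : is_max [set dot a x | x in C `|` opp_set C]
    (support (C `|` opp_set C) a).
  apply: support_is_max; first by exists c; left.
  by apply: compactU => //; exact: compact_opp_set.
set m := support _ a in xE xmax.
apply: (@sup_is_max _ m); split; first by exists x => // A [_]; exact.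
move=> _ [y /(_ [set z | dot a z <= m]) ym <-]; apply: ym; split.
  move=> u v l; rewrite !inE /= => um vm.
  rewrite -[leLHS]/(dot a (l%:num *: u + (1 - l%:num) *: v)).
  rewrite /dot linearD !linearZ /= mulmxDr -!scalemxAr.
  rewrite mxE [X in X + _]mxE [X in _ + X]mxE.
  rewrite [leRHS](_ : m = l%:num * m + (1 - l%:num) * m); last first.
    by rewrite -mulrDl addrC subrK mul1r.
  by rewrite lerD// ler_wpM2l// subr_ge0.
by move=> z CNz; apply: xmax; exists z.
Qed.

Lemma half_diff_compact K : compact K -> compact (half_diff K).
Proof.
move=> cK.
have -> : half_diff K =
    (fun z : 'rV[R]_n * 'rV[R]_n => 2^-1 *: (z.1 - z.2)) @` (K `*` K).
  apply/seteqP; split=> [_ [_ [x Kx [y Ky <-]] <-]|_ [[x y] /= [Kx Ky] <-]].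
    by exists (x, y).
  by exists (x - y) => //; exists x => //; exists y.
apply: continuous_compact; last exact: compact_setX.
apply: continuous_subspaceT => z.
by apply: cvgZr; apply: cvgB; [exact: cvg_fst|exact: cvg_snd].
Qed.

End attained.

(* Main.v *)
Require Import Defs.
From mathcomp Require Import ring.
Import Order.TTheory GRing.Theory Num.Theory.
Import numFieldNormedType.Exports.
Local Open Scope classical_set_scope.
Local Open Scope ring_scope.

Set Implicit Arguments.
Unset Strict Implicit.
Unset Printing Implicit Defensive.

(** Write h for support functions, w(s) = h_K(s) + h_K(-s) for the width of K
    in direction s, and M = conv (C U -C).

    Part (i) is a computation with support functions. A half-space contains M
    as soon as it contains C and -C, so h_M(s) = max(h_C(s), h_C(-s))
    ([support_C_MAX]); in particular h_M is even. The support function of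
    (K - K) / 2 is w / 2, which is even, so K and (K - K) / 2 have the same
    widths ([width_half_diff]). All the expressions in (i) are therefore
    w(s) / h_M(s), and taking maxima over s gives the equalities of (ii) among
    values of D_MAX.

    What remains is D_MAX(K, M) = D_AM(K, M). It holds for every gauge M with
    an even support function ([D_AM_even]) and expresses that the largest
    width of K relative to M is the largest length of a segment in K relative
    to M. If a segment [x, y] lies in a translate of rho M, then
    s.(x - y) <= 2 rho h_M(s); choosing x and y extremal in K for s and -s
    gives D_MAX <= D_AM. Conversely, if w <= r h_M, then no hyperplane
    separates x - y from r M, so x - y lies in r M ([sub_mem_dilate]), and
    likewise y - x; hence [x, y] lies in (x + y) / 2 + (r / 2) M.

    The separation theorem ([separation]) is obtained by projecting onto a
    compact convex set for the Euclidean scalar product. It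
    applies to M because M is compact: for convex C, the hull M is the set of all
    k a - (1 - k) b with a, b in C and k in [0, 1], a continuous image of a
    compact set ([C_MAX_compact]). *)

(** * The scalar product and separation *)

Section dot_theory.
Context {R : realType} {n : nat}.
Implicit Types (N : set 'rV[R]_n) (a b x y p : 'rV[R]_n).

Lemma dotC a x : dot a x = dot x a.
Proof. by rewrite !dotE; apply: eq_bigr => j _; rewrite mulrC. Qed.

Lemma dotNl a x : dot (- a) x = - dot a x.
Proof. by rewrite -scaleN1r dotZl mulN1r. Qed.

Lemma dotNr a x : dot a (- x) = - dot a x.
Proof. by rewrite dotC dotNl dotC. Qed.

Lemma dotBr a x y : dot a (x - y) = dot a x - dot a y.
Proof. by rewrite dotC dotBl dotC (dotC y). Qed.

Lemma dotDr a x y : dot a (x + y) = dot a x + dot a y.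
Proof. by rewrite -{1}[y]opprK dotBr dotNr opprK. Qed.

Lemma dotZr c a x : dot a (c *: x) = c * dot a x.
Proof. by rewrite dotC dotZl dotC. Qed.

Lemma dot_gt0 a : a != 0 -> 0 < dot a a.
Proof.
move=> a0; rewrite lt_def dotE sumr_ge0 ?andbT => [|j _]; last exact: sqr_ge0.
apply: contraNneq a0 => /eqP; rewrite psumr_eq0; last by move=> j _; exact: sqr_ge0.
move/allP => aa.
apply/eqP/rowP => j; have := aa j; rewrite mem_index_enum => /(_ isT).
by rewrite mulf_eq0 orbb mxE => /eqP.
Qed.

Lemma dist2_continuous p : continuous (fun x => dot (p - x) (p - x)).
Proof.
have -> : (fun x => dot (p - x) (p - x)) =
    \sum_j (fun x : 'rV[R]_n => (p - x) 0 j * (p - x) 0 j).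
  by apply/funext => x; rewrite dotE fct_sumE.
elim/big_ind: _ => [|f g cf cg|j _] x.
- exact: (@cst_continuous _ _ (0 : R)).
- exact: cvgD (cf x) (cg x).
- have cj : continuous (fun y : 'rV[R]_n => (p - y) 0 j).
    apply: (@lipschitz_cts _ _ _ 1) => u v; rewrite mul1r -lerBlDl distrC.
    rewrite [leLHS](_ : _ = (v - u) 0 j); last by rewrite !mxE; ring.
    by rewrite (le_trans (ler_norm _))// coord_norm.
  exact: cvgM (cj x) (cj x).
Qed.

(** The functional is [p - m], where [m] is the point of [N] nearest to [p]:
    moving from [m] towards any other point of [N] cannot decrease the
    distance to [p], and the first-order part of that condition is the claim. *)
Lemma separation N p : N !=set0 -> compact N -> convex_set N -> ~ N p ->
  exists2 a, a != 0 & support N a < dot a p.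
Proof.
move=> N0 cN convN Np.
have [m /set_mem Nm mmin] :=
  compact_EVT_min N0 cN (continuous_subspaceT (@dist2_continuous p)).
have a0 : p - m != 0 by apply: contra_notN Np; rewrite subr_eq0 => /eqP ->.
exists (p - m) => //; set a := p - m in a0 *.
have aa := dot_gt0 a0.
apply: (@le_lt_trans _ _ (dot a m)); last first.
  by rewrite -subr_gt0 -dotBr.
apply: support_le => // u Nu; rewrite -subr_le0 -dotBr.
set d := u - m; set g := dot a d; rewrite leNgt; apply/negP => g0.
have dd : 0 <= dot d d.
  by rewrite dotE sumr_ge0// => j _; exact: sqr_ge0.
(* |a - l d|^2 is least at l = g / |d|^2; adding g to the denominator keeps
   it positive and l <= 1, and such a shorter step still decreases it *)
pose l := g / (g + dot d d).
have gd : 0 < g + dot d d by rewrite ltr_wpDr.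
have l0 : 0 <= l by rewrite divr_ge0// ltW.
have l1 : l <= 1 by rewrite ler_pdivrMr// mul1r lerDl.
have lg : 0 < l by rewrite divr_gt0.
have Nv : N (l *: u + (1 - l) *: m).
  have := convN u m (@Itv01 R _ l0 l1); rewrite !inE => /(_ Nu Nm).
  exact.
have := mmin _ (mem_set Nv).
have -> : p - (l *: u + (1 - l) *: m) = a - l *: d.
  by apply/rowP => j; rewrite !mxE; ring.
rewrite -/a (dotBl a (l *: d)) !(dotBr _ a (l *: d)) !dotZl !dotZr (dotC d a).
rewrite -/g => le.
have {}le : 2 * g <= l * dot d d.
  rewrite -(ler_pM2l lg) -subr_ge0; move: le; rewrite -subr_ge0.
  by congr (0 <= _); ring.
have : l * (g + dot d d) = g by rewrite /l divfK ?gt_eqF.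
rewrite mulrDr => E; have : g + g <= g.
  rewrite -[X in _ <= X]E -mulr2n -[g *+ 2]mulr_natl.
  by rewrite (le_trans le)// lerDr mulr_ge0// ltW.
by rewrite gerDl leNgt g0.
Qed.

End dot_theory.

(** * Convex hulls of unions *)

Section hulls.
Context {R : realType} {n : nat}.
Implicit Types (A B C K : set 'rV[R]_n) (a x y : 'rV[R]_n).

Definition conv_join A B : set 'rV[R]_n :=
  [set z.1 *: z.2.1 + (1 - z.1) *: z.2.2 | z in `[0, 1] `*` (A `*` B)].

Lemma conv_join_compact A B : compact A -> compact B ->
  compact (conv_join A B).
Proof.
move=> cA cB; apply: continuous_compact; last first.
  by apply: compact_setX (compact_setX _ _) => //; exact: segment_compact.
apply: continuous_subspaceT => z.
have c1 : y.1 @[y --> z] --> z.1 by exact: cvg_fst.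
have c2 : y.2 @[y --> z] --> z.2 by exact: cvg_snd.
have c21 : y.2.1 @[y --> z] --> z.2.1.
  by apply: cvg_comp c2 _; exact: cvg_fst.
have c22 : y.2.2 @[y --> z] --> z.2.2.
  by apply: cvg_comp c2 _; exact: cvg_snd.
apply: cvgD; first exact: cvgZ.
by apply: cvgZ => //; apply: cvgB => //; exact: cvg_cst.
Qed.

Lemma convex_set_weights A (k l : R) x y : convex_set A -> 0 <= k -> 0 <= l ->
  A x -> A y -> exists2 z, A z & k *: x + l *: y = (k + l) *: z.
Proof.
move=> cA k0 l0 Ax Ay; have [kl0|kl0] := eqVneq (k + l) 0.
  exists x => //; move/eqP: (kl0); rewrite paddr_eq0// => /andP[/eqP -> /eqP ->].
  by rewrite addr0 !scale0r addr0.
have kl : 0 < k + l by rewrite lt_def kl0 addr_ge0.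
have p0 : 0 <= k / (k + l) by rewrite divr_ge0// ltW.
have p1 : k / (k + l) <= 1 by rewrite ler_pdivrMr// mul1r lerDl.
have := cA x y (@Itv01 R _ p0 p1); rewrite !inE => /(_ Ax Ay) Az.
exists ((k / (k + l)) *: x + (1 - k / (k + l)) *: y) => //.
by apply/rowP => j; rewrite !mxE; field.
Qed.

(** Collecting the weights on [A] and those on [B] separately turns a convex
    combination of two points of the join into a point of the join. *)
Lemma conv_join_convex A B : convex_set A -> convex_set B ->
  convex_set (conv_join A B).
Proof.
move=> cA cB x y l; rewrite !inE.
move=> [[k [a b]] [/= k01 [/= Aa Bb]] <-] [[k' [a' b']] [/= k01' [/= Aa' Bb']] <-].
have /andP[k0 k1] : 0 <= k <= 1 by move: k01; rewrite /= in_itv.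
have /andP[k0' k1'] : 0 <= k' <= 1 by move: k01'; rewrite /= in_itv.
have t0 : 0 <= l%:num by [].
have t1 : 0 <= 1 - l%:num by rewrite subr_ge0.
set t := l%:num in t0 t1 *.
have h0 : 0 <= t * k by rewrite mulr_ge0.
have h0' : 0 <= (1 - t) * k' by rewrite mulr_ge0.
have h1 : 0 <= t * (1 - k) by rewrite mulr_ge0// subr_ge0.
have h1' : 0 <= (1 - t) * (1 - k') by rewrite mulr_ge0// subr_ge0.
have [a'' Aa'' Ea] := convex_set_weights cA h0 h0' Aa Aa'.
have [b'' Bb'' Eb] := convex_set_weights cB h1 h1' Bb Bb'.
exists (t * k + (1 - t) * k', (a'', b'')) => /=.
  split => //=; rewrite in_itv /= addr_ge0//= -subr_ge0.
  rewrite (_ : _ - _ = t * (1 - k) + (1 - t) * (1 - k')); last by ring.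
  exact: addr_ge0.
rewrite (_ : 1 - (_ + _) = t * (1 - k) + (1 - t) * (1 - k')); last by ring.
rewrite -Ea -Eb -[RHS]/(t *: _ + (1 - t) *: _).
by apply/rowP => j; rewrite !mxE; ring.
Qed.

Lemma opp_set_convex C : convex_set C -> convex_set (opp_set C).
Proof.
move=> cC x y l; rewrite !inE => -[a Ca <-] [b Cb <-].
exists (l%:num *: a + (1 - l%:num) *: b); last first.
  by rewrite -[RHS]/(_ *: _ + _ *: _) !scalerN -opprD.
by have := cC a b l; rewrite !inE; exact.
Qed.

(** Describes the hull, defined as an intersection of convex sets, by
    explicit parameters, from which its compactness follows. *)
Lemma C_MAX_conv_join C : C !=set0 -> convex_set C ->
  C_MAX C = conv_join C (opp_set C).
Proof.
move=> [c Cc] cC; apply/seteqP; split.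
  apply: smallest_sub.
    by apply: conv_join_convex => //; exact: opp_set_convex.
  move=> x [Cx|Cx].
    exists (1, (x, - c)); last by rewrite /= subrr scale0r scale1r addr0.
    by split=> /=; [rewrite in_itv /= ler01 lexx | split=> //; exists c].
  exists (0, (c, x)); last by rewrite /= subr0 scale0r scale1r add0r.
  by split=> /=; [rewrite in_itv /= ler01 lexx | split].
move=> _ [[k [a b]] [/= k01 [/= Ca Cb]] <-].
have /andP[k0 k1] : 0 <= k <= 1 by move: k01; rewrite /= in_itv.
have Ma : C_MAX C a by exact: sub_C_MAX.
have Mb : C_MAX C b by move=> D [_ CD]; apply: CD; right.
by have := @C_MAX_convex _ _ C a b (@Itv01 R _ k0 k1); rewrite !inE; exact.
Qed.

Lemma C_MAX_compact C : C !=set0 -> compact C -> convex_set C ->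
  compact (C_MAX C).
Proof.
move=> C0 kC cC; rewrite C_MAX_conv_join//; apply: conv_join_compact => //.
exact: compact_opp_set.
Qed.

Lemma C_MAX_convex_body C : convex_body C -> convex_body (C_MAX C).
Proof.
move=> [C0 kC cC]; split; [|exact: C_MAX_compact|exact: C_MAX_convex].
by have [c Cc] := C0; exists c; exact: sub_C_MAX.
Qed.

(** * Support functions and widths *)

Lemma support_C_MAX C a : C !=set0 -> bounded_set C ->
  support (C_MAX C) a = Num.max (support C a) (support C (- a)).
Proof.
move=> C0 bC; have [c Cc] := C0; set m := Num.max _ _.
have bM := C_MAX_bounded bC.
apply/le_anti/andP; split.
  apply: support_le; first by exists c; exact: sub_C_MAX.
  move=> x /(_ [set z | dot a z <= m]); apply; split.
    move=> u v l; rewrite !inE /= => um vm.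
    rewrite -[leLHS]/(dot a (l%:num *: u + (1 - l%:num) *: v)) dotDr !dotZr.
    rewrite [leRHS](_ : m = l%:num * m + (1 - l%:num) * m); last by ring.
    by rewrite lerD// ler_wpM2l// subr_ge0.
  move=> y [Cy|[z Cz <-]] /=; rewrite /m le_max.
    by rewrite support_ub.
  by rewrite dotNr -dotNl (support_ub _ bC Cz) orbT.
rewrite ge_max; apply/andP; split; apply: support_le => // x Cx.
  by apply: support_ub => //; exact: sub_C_MAX.
rewrite dotNl -dotNr; apply: support_ub => //.
by move=> D [_ CD]; apply: CD; right; exists x.
Qed.

Lemma support_half_diff K a : K !=set0 -> compact K ->
  support (half_diff K) a = 2^-1 * (support K a + support K (- a)).
Proof.
move=> K0 cK; have bK := compact_bounded cK.
apply/le_anti/andP; split.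
  apply: support_le.
    have [x Kx] := K0; exists (2^-1 *: (x - x)), (x - x) => //.
    by exists x => //; exists x.
  move=> _ [_ [x Kx [y Ky <-]] <-]; rewrite dotZr ler_pM2l ?invr_gt0//.
  by rewrite dotBr -dotNl lerD// support_ub.
have [[x Kx <-] _] := support_is_max a K0 cK.
have [[y Ky <-] _] := support_is_max (- a) K0 cK.
rewrite dotNl -dotBr -dotZr; apply: support_ub.
  by apply: compact_bounded; exact: half_diff_compact.
by exists (x - y) => //; exists x => //; exists y.
Qed.

Lemma width_half_diff K a : K !=set0 -> compact K ->
  support (half_diff K) a + support (half_diff K) (- a) =
  support K a + support K (- a).
Proof. by move=> K0 cK; rewrite !support_half_diff// opprK; field. Qed.

Lemma width_ge0 K a : K !=set0 -> bounded_set K ->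
  0 <= support K a + support K (- a).
Proof.
move=> [x Kx] bK; rewrite -(subrr (dot a x)) -dotNl.
by rewrite lerD// support_ub.
Qed.

Lemma b_MAX_even K C a : support C (- a) = support C a ->
  b_MAX a K C = (support K a + support K (- a)) / support C a.
Proof. by move=> e; rewrite /b_MAX e maxxx. Qed.

End hulls.

(** * Circumradii of segments *)

Section segments.
Context {R : realType} {n : nat}.
Implicit Types (K C M : set 'rV[R]_n) (s x y t : 'rV[R]_n).

Lemma segment_homothet_dot C s x y t (rho : R) : bounded_set C -> 0 <= rho ->
  segment x y `<=` homothet t rho C ->
  dot s (x - y) <= rho * (support C s + support C (- s)).
Proof.
move=> bC rho0 xyC.
have [c Cc xE] : homothet t rho C x.
  apply: xyC; exists 0; rewrite /= ?in_itv /= ?lexx ?ler01//.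
  by rewrite subr0 scale1r scale0r addr0.
have [d Cd yE] : homothet t rho C y.
  apply: xyC; exists 1; rewrite /= ?in_itv /= ?lexx ?ler01//.
  by rewrite subrr scale1r scale0r add0r.
rewrite -xE -yE opprD addrACA subrr add0r -scalerBr dotZr ler_wpM2l//.
by rewrite dotBr -dotNl lerD// support_ub.
Qed.

(** The point of [[x, y]] with parameter [l] differs from the midpoint by
    half of [(1 - l) *: (x - y) + l *: (y - x)], a convex combination of two
    points of [r *: M]. *)
Lemma segment_homothet_midpoint M x y m m' (r : R) : convex_set M ->
  M m -> M m' -> x - y = r *: m -> y - x = r *: m' ->
  segment x y `<=` homothet (2^-1 *: (x + y)) (r / 2) M.
Proof.
move=> cM Mm Mm' xy yx _ [l l01 <-].
have /andP[l0 l1] : 0 <= l <= 1 by move: l01; rewrite /= in_itv.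
have k0 : 0 <= 1 - l by rewrite subr_ge0.
have k1 : 1 - l <= 1 by rewrite gerBl.
exists ((1 - l) *: m + l *: m').
  have := cM m m' (@Itv01 R _ k0 k1); rewrite !inE => /(_ Mm Mm').
  rewrite -[X in M X -> _]/((1 - l) *: m + (1 - (1 - l)) *: m').
  by rewrite subKr.
rewrite (_ : (r / 2) *: _ = 2^-1 *: ((1 - l) *: (r *: m) + l *: (r *: m'))).
  by rewrite -xy -yx; apply/rowP => j; rewrite !mxE; field.
by apply/rowP => j; rewrite !mxE; field.
Qed.

(** A functional separating [x - y] from [r *: M] would see a width of [K]
    larger than [r] times the support function of [M]. *)
Lemma sub_mem_dilate K M x y (r : R) : bounded_set K -> convex_body M ->
  0 < r -> (forall s, s != 0 -> support K s + support K (- s) <= r * support M s) ->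
  K x -> K y -> exists2 m, M m & x - y = r *: m.
Proof.
move=> bK [M0 kM cM] r0 wr Kx Ky; exists (r^-1 *: (x - y)); last first.
  by rewrite scalerA divff ?scale1r// gt_eqF.
have [//|nM] := pselect (M (r^-1 *: (x - y))).
have [s s0] := separation M0 kM cM nM.
rewrite dotZr ltr_pdivlMl// ltNge => /negP[].
by rewrite (le_trans _ (wr s s0))// dotBr -dotNl lerD// support_ub.
Qed.

(** [segment_homothet_dot] bounds the widths of [K] by the circumradii of its
    segments, and [sub_mem_dilate] gives the converse bound. An arbitrary [e > 0] is added to [D_MAX K M]
    because the dilation factor in [sub_mem_dilate] has to be positive, whereas
    [D_MAX K M] vanishes when [K] is a point. *)
Lemma D_AM_even K M : (0 < n)%N -> convex_body K -> convex_body M -> M° 0 ->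
  (forall s, support M (- s) = support M s) -> D_AM K M = D_MAX K M.
Proof.
move=> n0 [K0 kK _] bodyM iM evenM; have [M0 kM cM] := bodyM.
have bK := compact_bounded kK; have bM := compact_bounded kM.
have [[s /= s0 sD] Dub] := D_MAX_is_max n0 K0 bK bM iM.
have hM a : a != 0 -> 0 < support M a by exact: support_gt0.
have D0 : 0 <= D_MAX K M.
  by rewrite -sD b_MAX_even// divr_ge0 ?width_ge0// ltW ?hM.
have widthD a : a != 0 ->
    support K a + support K (- a) <= D_MAX K M * support M a.
  move=> a0; rewrite -ler_pdivrMr ?hM// -b_MAX_even//.
  by apply: Dub; exists a.
have inradii x y (e : R) : K x -> K y -> 0 < e ->
    [set rho : R | 0 <= rho /\ exists t, segment x y `<=` homothet t rho M]
      ((D_MAX K M + e) / 2).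
  move=> Kx Ky e0; have r0 : 0 < D_MAX K M + e by rewrite ltr_wpDl.
  have wr a : a != 0 ->
      support K a + support K (- a) <= (D_MAX K M + e) * support M a.
    move=> a0; rewrite (le_trans (widthD a a0))// ler_wpM2r ?lerDl ?ltW//.
    exact: hM.
  have [m Mm xy] := sub_mem_dilate bK bodyM r0 wr Kx Ky.
  have [m' Mm' yx] := sub_mem_dilate bK bodyM r0 wr Ky Kx.
  split; first by rewrite divr_ge0// ltW.
  by exists (2^-1 *: (x + y)); exact: segment_homothet_midpoint xy yx.
have [[x Kx [y Ky xyE]] ub] := D_AM_is_max K0 kK cM iM.
apply/le_anti/andP; split.
  apply/ler_addgt0Pr => e e0; rewrite -xyE -ler_pdivlMl// mulrC.
  by apply: ge_inf; [exists 0 => ? [] | exact: inradii].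
have [[u Ku uE] _] := support_is_max s K0 kK.
have [[v Kv vE] _] := support_is_max (- s) K0 kK.
apply: (@le_trans _ _ (2 * circumradius (segment u v) M)); last first.
  by apply: ub; exists u => //; exists v.
rewrite -ler_pdivrMl// mulrC; apply: lb_le_inf.
  by exists ((D_MAX K M + 1) / 2); exact: inradii.
move=> rho [rho0 [t /(segment_homothet_dot s bM rho0)]].
rewrite dotBr -dotNl uE vE evenM => le.
rewrite -sD b_MAX_even// ler_pdivrMr// ler_pdivrMr ?hM//.
by rewrite (le_trans le)// -mulrA mulr_natl mulr2n.
Qed.

End segments.

(** * Breadths and diameters *)

Theorem lemma2p8 (R : realType) (n : nat) (K C : set 'rV[R]_n)
    (s : 'rV[R]_n) :
  (2 <= n)%N ->
  convex_body K ->
  convex_body C ->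
  Minkowski_centered C ->
  C° 0 ->
  s != 0 ->
  [/\ b_MAX s K C = (support K s + support K (- s)) / support (C_MAX C) s,
      (support K s + support K (- s)) / support (C_MAX C) s
        = b_MAX s K (C_MAX C),
      b_MAX s K (C_MAX C) = b_AM s K (C_MAX C),
      b_AM s K (C_MAX C) = b_MAX s (half_diff K) (C_MAX C) &
      b_MAX s (half_diff K) (C_MAX C) = b_MAX s (half_diff K) C]
  /\
  [/\ D_MAX K C = D_MAX K (C_MAX C),
      D_MAX K (C_MAX C) = D_MAX (half_diff K) (C_MAX C),
      D_MAX (half_diff K) (C_MAX C) = D_MAX (half_diff K) C &
      D_MAX (half_diff K) C = D_AM K (C_MAX C)].
Proof.
move=> n2 bodyK bodyC _ iC _.
have [K0 kK _] := bodyK; have [C0 kC _] := bodyC.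
have bC := compact_bounded kC.
have evenM a : support (C_MAX C) (- a) = support (C_MAX C) a.
  by rewrite !support_C_MAX// opprK maxC.
have toM a L : b_MAX a L C = b_MAX a L (C_MAX C).
  by rewrite [RHS]b_MAX_even// support_C_MAX.
have toK a L : b_MAX a (half_diff K) L = b_MAX a K L.
  by rewrite /b_MAX width_half_diff.
have DtoM L : D_MAX L C = D_MAX L (C_MAX C).
  by congr sup; apply: eq_imagel => a _.
have DtoK L : D_MAX (half_diff K) L = D_MAX K L.
  by congr sup; apply: eq_imagel => a _.
have AM : b_AM s K (C_MAX C) = b_MAX s K (C_MAX C).
  rewrite b_MAX_even// /b_AM evenM -mulr2n -(mulr_natl (support _ s)) invfM.
  by rewrite mulrCA [2 * _]mulrA divff ?mul1r// pnatr_eq0.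
split.
  by split; rewrite ?AM ?toK ?toM ?b_MAX_even.
split; rewrite ?DtoM ?DtoK//.
rewrite D_AM_even ?(ltnW n2)//; first exact: C_MAX_convex_body.
exact: C_MAX_interior.
Qed.
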